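(* In the setting described in the context, approximate the post-decision potential function by $U(\widetilde{\mathbf E},\widetilde{\mathbf Q})\approx\hat U(\widetilde{\mathbf E},\widetilde{\mathbf Q})=\sum_{b\in\mathcal B}\sum_{k\in\mathcal K_b}\hat U_k(\widetilde E_b,\widetilde Q_k)$, where $\hat U_k$ are the per-flow potential functions, and let $\hat{\mathbf p}^*=\hat{\mathbf p}^*(\mathbf E,\mathbf Q)=\arg\min_{\mathbf p\in\boldsymbol{\mathcal P}}\sum_{b\in\mathcal B}\sum_{k\in\mathcal K_b}\hat{\mathbb Q}_k(E_b,Q_k,\mathbf p)$. Substituting this linear approximation and $\hat{\mathbf p}^*$ into the user scheduling rule $$\arg\min_{\mathbf s\in\boldsymbol{\mathcal S}(\hat{\mathbf p}^* )}\Big\{\sum_{\mathbf d\in\{0,1\}^K}\Big(\prod_{k\in\mathcal K}\big(1-d_k-(-1)^{d_k}\Pr[\rho_k\ge\delta_k]\big)\,\hat U\big([\mathbf E-\hat{\mathbf p}^*]^+,[\mathbf Q-\mathbf d]^+\big)\Big)\Big\},$$ the resulting (distributed) user scheduling action $\hat{\mathbf s}_n^*$ of the $n$-th cluster, based on the per-cluster energy state, queue state and CSI, is given, for every $n$ and all $\mathbf E_n,\mathbf Q_n,\mathbf H_n$, by $$\hat{\mathbf s}_n^*(\mathbf E_n,\mathbf Q_n,\mathbf H_n)=\arg\max_{\mathbf s_n\in\boldsymbol{\mathcal S}_n(\hat{\mathbf p}_n^* )}\sum_{k\in\mathcal K^{(n)}}s_k\Pr[\rho_k(\mathbf H_n,\hat{\mathbf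 p}^*,\mathbf s_n)\ge\delta_k]\Big(\hat U_k([E_b-\hat p_b^*]^+,Q_k)-\hat U_k([E_b-\hat p_b^*]^+,[Q_k-1]^+)\Big),$$ where in the summand $b$ is the BS with $k\in\mathcal K_b$, and $\boldsymbol{\mathcal S}_n(\mathbf p_n)=\{\mathbf s_n\in\{0,1\}^{\sum_{b\in\mathcal B_n}|\mathcal K_b|}:\sum_{k\in\mathcal K_b}s_k=p_b,\ b\in\mathcal B_n\}$.
   Context: **System.** There are $B$ base stations (BSs), each with $N_t$ antennas, and $K$ single-antenna mobile stations (MSs). $\mathcal B=\{1,\dots,B\}$ is partitioned into $N=B/N_t$ clusters $\mathcal B_1,\dots,\mathcal B_N$ of $N_t$ BSs each. The set $\mathcal K$ of MSs is the disjoint union of the sets $\mathcal K_b$ (MSs associated with BS $b$); $\mathcal K^{(n)}=\bigcup_{b\in\mathcal B_n}\mathcal K_b$. The fading vector from BS $b$ to MS $k$ is $\mathbf h_{k,b}(t)\in\mathcal H$, a finite subset of $\mathbb C^{N_t}$; its entries have mean 0 and variance 1, it is i.i.d. over slots $t$ and independent over $(k,b)$. Path gains $L_{k,b}$ and transmit powers $P_b$ are constants. The per-cluster CSI is $\mathbf H_n=\{\mathbf h_{k,b}:k\in\mathcal K_b,b\in\mathcal B_n\}$ and $\mathbf H=\bigcup_n\mathbf H_n\in\boldsymbol{\mathcal H}$. BS-DTX (discontinuous transmission) actions are $\mathbf p=(p_b)\in\boldsymbol{\mathcal P}\subseteq\{0,1\}^B$, user scheduling actions are $\mathbf s=(s_k)\in\boldsymbol{\mathcal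 S}\subseteq\{0,1\}^K$; $\mathbf p_n,\mathbf s_n,\mathbf E_n,\mathbf Q_n$ are the sub-vectors belonging to cluster $n$. $\boldsymbol{\mathcal S}(\mathbf p)=\{\mathbf s\in\boldsymbol{\mathcal S}:\sum_{k\in\mathcal K_b}s_k=p_b,\ b\in\mathcal B\}$. For $k\in\mathcal K_b$, $b\in\mathcal B_n$, the SINR is $\rho_k=P_k^{rx}/(N_0+I_k)$, with $P_k^{rx}=p_bP_bL_{k,b}\|\mathbf h_{k,b}^T\mathbf w_{k,b}\|^2s_k$ and $I_k=\sum_{n'\ne n}\sum_{b'\in\mathcal B_{n'}}p_{b'}P_{b'}L_{k,b'}\|\mathbf h_{k,b'}^T(\sum_{k'\in\mathcal K_{b'}}\mathbf w_{k',b'}s_{k'})\|^2$, where $N_0>0$ and the zero-forcing beamformers $\mathbf w_{k,b}$ solve $\sum_{k\in\mathcal K_b}\|\mathbf w_{k,b}\|^2s_k=p_b$ and $s_k\mathbf h_{k,b'}^T(\sum_{k'\in\mathcal K_{b'}}\mathbf w_{k',b'}s_{k'})=0$ for all $b'\in\mathcal B_n$, $b'\ne b$ (if several solutions, the one maximizing $\|\mathbf h_{k,b}^T\mathbf w_{k,b}\|^2$). A packet of MS $k$ is received in a slot iff $\rho_k\ge\delta_k$ ($\delta_k>0$). The success probability of MS $k$ in cluster $n$ is evaluated from the cluster's CSI and scheduling and the BS-DTX action, and is written $\Pr[\rho_k(\mathbf H_n,\mathbf p,\mathbf s_n)\ge\delta_k]$. **Queues.** Data arrivals $A^Q_k(t)$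 and renewable energy arrivals $A^E_b(t)$ are nonnegative-integer valued, i.i.d. over $t$, independent over $k$ and $b$, with means less than 1. With $x^+=\max\{x,0\}$ (componentwise), $Q_k\in\{0,\dots,N_Q\}$ and $E_b\in\{0,\dots,N_E\}$ evolve by $Q_k(t+1)=\min\{[Q_k(t)-\mathbf I[\rho_k(t)\ge\delta_k]]^++A^Q_k(t),N_Q\}$, $E_b(t+1)=\min\{[E_b(t)-p_b(t)]^++A^E_b(t),N_E\}$. The post-decision state after an action and before arrivals is $\widetilde E_b'=[E_b-p_b]^+$, $\widetilde Q_k'=[Q_k-\mathbf I[\rho_k\ge\delta_k]]^+$. **Per-flow functions.** Let $\hat\Omega=(\hat\Omega_p,\hat\Omega_s)$ be a randomized base policy: $\hat\Omega_p$ is a probability distribution on $\boldsymbol{\mathcal P}$, $\hat\Omega_s$ maps $\mathbf H$ to a probability distribution on $\boldsymbol{\mathcal S}$. With $\beta_k,\gamma_b>0$, $f$ monotonically increasing, $\hat g_k(E_b,Q_k,p_b)=\beta_kf(Q_k)+\gamma_bp_b\mathbf I[E_b=0]\mathbb E[\hat\Pr[s_k=1|\mathbf H]]$ and $\hat\Pr[\,\cdot\,|(E_b,Q_k),\mathbf p]=\mathbb E[\mathbb E^{\hat\Omega_s}[\Pr[\,\cdot\,|(E_b,Q_k,\mathbf H),\mathbf p,\mathbf s]|\mathbf H]]$, the per-flow functions are given by the fixed point equations $\hat\theta_k+\hat{\mathbb Q}_k(E_b,Q_k,\mathbf p)=\hat g_k(E_b,Q_k,p_b)+\sum_{(E_b',Q_k')}\hat\Pr[(E_b',Q_k')|(E_b,Q_k),\mathbf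 p]\mathbb E^{\hat\Omega_p}[\hat{\mathbb Q}_k(E_b',Q_k',\mathbf p')]$ and $\hat\theta_k+\hat U_k(\widetilde E_b,\widetilde Q_k)=\sum_{(A^E_b,A^Q_k)}\Pr[A^E_b]\Pr[A^Q_k]\big(\mathbb E^{\hat\Omega_p}[\hat g_k(E_b,Q_k,p_b)]+\sum_{(\widetilde E_b',\widetilde Q_k')}\mathbb E^{\hat\Omega_p}[\hat\Pr[(\widetilde E_b',\widetilde Q_k')|(E_b,Q_k),\mathbf p]]\hat U_k(\widetilde E_b',\widetilde Q_k')\big)$, with $E_b=\min\{\widetilde E_b+A^E_b,N_E\}$, $Q_k=\min\{\widetilde Q_k+A^Q_k,N_Q\}$.
   Formalization: The formal statement assumes that, for p in P, the set S contains every user scheduling action whose cluster parts all lie in S_n(p_n); for smaller S the claim fails, since S(p) is then not the product of the S_n(p_n). *)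

(* Defs.v *)
From HB Require Import structures.
From mathcomp Require Import all_boot all_order all_algebra.
From mathcomp Require Import all_classical all_reals all_analysis.
From mathcomp Require Import complex.

Set Implicit Arguments.
Unset Strict Implicit.
Unset Printing Implicit Defensive.

Import Order.TTheory GRing.Theory Num.Theory.
Import numFieldNormedType.Exports.
Local Open Scope ring_scope.

(* Minimizers and maximizers need not be unique, so argmin and argmax denote
   the sets of all of them. *)
Definition argmin (R : realType) (T : finType) (A : {set T}) (F : T -> R) :
  {set T} := [set x in A | [forall y in A, F x <= F y]].

Definition argmax (R : realType) (T : finType) (A : {set T}) (F : T -> R) :
  {set T} := [set x in A | [forall y in A, F y <= F x]].

Definition subvec (T : finType) (V : Type) (P : pred T) (x : {ffun T -> V}) :
  {ffun {t : T | P t} -> V} := [ffun t => x (val t)].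

(* [x - d]^+ on {0, ..., m}: subtraction on nat is truncated at 0. *)
Definition deplete (m : nat) (x : 'I_m.+1) (d : bool) : 'I_m.+1 :=
  inord (x - nat_of_bool d)%N.

Definition depletev (T : finType) (m : nat) (x : {ffun T -> 'I_m.+1})
  (d : {ffun T -> bool}) : {ffun T -> 'I_m.+1} :=
  [ffun t => deplete (x t) (d t)].

(* min {x + a, m} *)
Definition replenish (m : nat) (x : 'I_m.+1) (a : nat) : 'I_m.+1 :=
  inord (minn (x + a) m).

Definition is_pmf (R : realType) (T : finType) (A : {set T}) (mu : T -> R) :=
  [/\ forall x, 0 <= mu x, \sum_x mu x = 1 & forall x, x \notin A -> mu x = 0].

Definition is_arrival_law (R : realType) (mu : nat -> R) :=
  [/\ forall a, 0 <= mu a,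
      (\sum_(0 <= a <oo) (mu a)%:E = 1)%E
    & (\sum_(0 <= a <oo) (a%:R * mu a)%:E < 1)%E].

(* Only used for bounded F, for which the series converges absolutely. *)
Definition arrival_mean (R : realType) (mu : nat -> R) (F : nat -> R) : R :=
  limn (series (fun a => mu a * F a)).

Definition sqmod (R : realType) (z : complex R) : R :=
  complex.Re z ^+ 2 + complex.Im z ^+ 2.

Definition sqnorm (R : realType) (m : nat) (w : 'cV[complex R]_m) : R :=
  \sum_i sqmod (w i 0).

(* h^T w, without conjugation *)
Definition pairing (R : realType) (m : nat) (h w : 'cV[complex R]_m) :
  complex R := (h^T *m w) 0 0.

(* serving k is the BS b with k in K_b, so that the K_b partition the MSs. *)
Record network (R : realType) := Network {
  nBS : nat;
  nMS : nat;
  nCl : nat;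
  nAnt : nat;
  cluster : 'I_nBS -> 'I_nCl;
  serving : 'I_nMS -> 'I_nBS;
  fadings : seq 'cV[complex R]_nAnt
}.

Section Network.
Variables (R : realType) (net : network R).

Definition bs_action := {ffun 'I_(nBS net) -> bool}.
Definition ms_action := {ffun 'I_(nMS net) -> bool}.
Definition fading := seq_sub (fadings net).
Definition links := {ffun 'I_(nMS net) * 'I_(nBS net) -> fading}.

Definition in_cluster_bs (n : 'I_(nCl net)) : pred 'I_(nBS net) :=
  fun b => cluster b == n.
Definition in_cluster_ms (n : 'I_(nCl net)) : pred 'I_(nMS net) :=
  fun k => cluster (serving k) == n.
Definition cluster_bs (n : 'I_(nCl net)) := {b | in_cluster_bs n b}.
Definition cluster_ms (n : 'I_(nCl net)) := {k | in_cluster_ms n k}.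

Definition bs_part (V : Type) (n : 'I_(nCl net))
  (x : {ffun 'I_(nBS net) -> V}) : {ffun cluster_bs n -> V} :=
  subvec (in_cluster_bs n) x.
Definition ms_part (V : Type) (n : 'I_(nCl net))
  (x : {ffun 'I_(nMS net) -> V}) : {ffun cluster_ms n -> V} :=
  subvec (in_cluster_ms n) x.

Definition local_serving (n : 'I_(nCl net)) (k : cluster_ms n) :
  cluster_bs n := exist _ (serving (val k)) (valP k).

(* The CSI consists of the vectors h_{k,b} with k in K_b only. *)
Definition csi := {ffun 'I_(nMS net) -> fading}.
Definition csi_of_links (h : links) : csi := [ffun k => h (k, serving k)].

End Network.

(* A beamformer w_{k,b} is only used for b = serving k and is indexed by k.
   Time does not appear: all laws are those of one slot.

   The SINR of an MS in cluster n also involves the schedule of the other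
   clusters, which (H_n, p, s_n) does not determine.  outer_schedule n h p s_n
   is the law of the complete schedule used when the success probability of
   the MSs of cluster n is evaluated; nothing is assumed about it beyond its
   agreement with s_n on cluster n. *)
Record system (R : realType) := System {
  net :> network R;
  fading_law : 'I_(nMS net) -> 'I_(nBS net) -> fading net -> R;
  gain : 'I_(nMS net) -> 'I_(nBS net) -> R;
  power : 'I_(nBS net) -> R;
  noise : R;
  threshold : 'I_(nMS net) -> R;
  bs_actions : {set bs_action net};
  ms_actions : {set ms_action net};
  beam : links net -> bs_action net -> ms_action net -> 'I_(nMS net) ->
         'cV[complex R]_(nAnt net);
  outer_schedule : forall n : 'I_(nCl net), links net -> bs_action net ->
         {ffun cluster_ms n -> bool} -> ms_action net -> R;
  NQ : nat;
  NE : nat;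
  arrQ : 'I_(nMS net) -> nat -> R;
  arrE : 'I_(nBS net) -> nat -> R;
  beta : 'I_(nMS net) -> R;
  gamma : 'I_(nBS net) -> R;
  qcost : nat -> R
}.

Section System.
Variables (R : realType) (sys : system R).

Notation BS := 'I_(nBS sys).
Notation MS := 'I_(nMS sys).
Notation CL := 'I_(nCl sys).
Notation cvec := 'cV[complex R]_(nAnt sys).
Notation bs_action := (bs_action sys).
Notation ms_action := (ms_action sys).
Notation fading := (fading sys).
Notation links := (links sys).
Notation csi := (csi sys).

Definition energy := 'I_(NE sys).+1.
Definition queue := 'I_(NQ sys).+1.

(* sum_{k in K_b} w_{k,b} s_k *)
Definition beam_sum (s : ms_action) (w : MS -> cvec) (b : BS) : cvec :=
  \sum_(k | serving k == b) (s k)%:R *: w k.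

(* The zero-forcing equations, grouped by the BS b whose beams they constrain:
   this makes sense of the beams of b when the equations of another BS have no
   solution (e.g. p_{b'} = 1 but no scheduled MS in K_{b'}). *)
Definition zf_solution (h : links) (p : bs_action) (s : ms_action) (b : BS)
    (w : MS -> cvec) : Prop :=
  \sum_(k | serving k == b) sqnorm (w k) * (s k)%:R = (p b)%:R /\
  forall k, cluster (serving k) = cluster b -> serving k != b ->
    (s k)%:R * pairing (ssval (h (k, b))) (beam_sum s w b) = 0.

Definition zf_optimal (h : links) (p : bs_action) (s : ms_action) (b : BS)
    (w : MS -> cvec) : Prop :=
  zf_solution h p s b w /\
  forall w', zf_solution h p s b w' -> forall k, serving k = b -> s k ->
    sqmod (pairing (ssval (h (k, b))) (w' k)) <=
    sqmod (pairing (ssval (h (k, b))) (w k)).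

Definition zf_beams : Prop :=
  forall (h : links) (p : bs_action) (s : ms_action) (b : BS),
    ((exists w, zf_solution h p s b w) -> zf_solution h p s b (beam h p s)) /\
    ((exists w, zf_optimal h p s b w) -> zf_optimal h p s b (beam h p s)).

Definition rx_power (h : links) (p : bs_action) (s : ms_action) (k : MS) : R :=
  (p (serving k))%:R * power (serving k) * gain k (serving k) *
  sqmod (pairing (ssval (h (k, serving k))) (beam h p s k)) * (s k)%:R.

Definition interference (h : links) (p : bs_action) (s : ms_action) (k : MS) :
    R :=
  \sum_(n' | n' != cluster (serving k)) \sum_(b' | cluster b' == n')
    (p b')%:R * power b' * gain k b' *
    sqmod (pairing (ssval (h (k, b'))) (beam_sum s (beam h p s) b')).

Definition sinr (h : links) (p : bs_action) (s : ms_action) (k : MS) : R :=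
  rx_power h p s k / (noise sys + interference h p s k).

(* The law of all fading vectors given the CSI Hn of cluster n; by
   independence, the vectors outside Hn keep their own laws. *)
Definition links_law_given (n : CL) (Hn : {ffun cluster_ms n -> fading})
    (h : links) : R :=
  (ms_part n (csi_of_links h) == Hn)%:R *
  \prod_(kb : MS * BS | ~~ ((serving kb.1 == kb.2) && (cluster kb.2 == n)))
    fading_law kb.1 kb.2 (h kb).

(* Pr[rho_k(H_n, p, s_n) >= delta_k], for k in cluster n *)
Definition success_prob (n : CL) (Hn : {ffun cluster_ms n -> fading})
    (p : bs_action) (sn : {ffun cluster_ms n -> bool}) (k : MS) : R :=
  \sum_(h : links) links_law_given Hn h *
    \sum_(s : ms_action) outer_schedule h p sn s *
      (threshold k <= sinr h p s k)%R%:R.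

(* The same probability, from the network-wide CSI and schedule. *)
Definition success (H : csi) (p : bs_action) (s : ms_action) (k : MS) : R :=
  let n := cluster (serving k) in
  success_prob (ms_part n H) p (ms_part n s) k.

Record standing : Prop := Standing {
  antennas_gt0 : (0 < nAnt sys)%N;
  cluster_size : forall n : CL, #|[set b : BS | cluster b == n]| = nAnt sys;
  fading_pmf : forall (k : MS) (b : BS),
    is_pmf [set: fading] (fading_law k b);
  fading_mean0 : forall (k : MS) (b : BS) i,
    \sum_(x : fading) (fading_law k b x)%:C%C * ssval x i 0 = 0;
  fading_var1 : forall (k : MS) (b : BS) i,
    \sum_(x : fading) fading_law k b x * sqmod (ssval x i 0) = 1;
  noise_gt0 : 0 < noise sys;
  threshold_gt0 : forall k : MS, 0 < threshold k;
  beam_zf : zf_beams;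
  outer_schedule_pmf : forall (n : CL) (h : links) (p : bs_action)
      (sn : {ffun cluster_ms n -> bool}),
    is_pmf [set s : ms_action | ms_part n s == sn] (outer_schedule h p sn);
  arrQ_law : forall k : MS, is_arrival_law (arrQ k);
  arrE_law : forall b : BS, is_arrival_law (arrE b);
  beta_gt0 : forall k : MS, 0 < beta k;
  gamma_gt0 : forall b : BS, 0 < gamma b;
  qcost_incr : {homo (@qcost R sys) : x y / (x <= y)%N >-> x <= y}
}.

Record base_policy := BasePolicy {
  base_p : bs_action -> R;
  base_s : csi -> ms_action -> R;
  base_p_pmf : is_pmf (bs_actions sys) base_p;
  base_s_pmf : forall H, is_pmf (ms_actions sys) (base_s H)
}.

Variable om : base_policy.

Definition csi_law (H : csi) : R := \prod_k fading_law k (serving k) (H k).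

(* E[E^{Omega_s}[F(H, s) | H]] *)
Definition mean_Hs (F : csi -> ms_action -> R) : R :=
  \sum_H csi_law H * \sum_s base_s om H s * F H s.

(* E^{Omega_p}[F(p)] *)
Definition mean_p (F : bs_action -> R) : R := \sum_p base_p om p * F p.

Definition flow_cost (k : MS) (E : energy) (Q : queue) (pb : bool) : R :=
  beta k * qcost sys Q +
  gamma (serving k) * pb%:R * (E == ord0)%:R * mean_Hs (fun _ s => (s k)%:R).

(* Pr[(E', Q') | (E, Q, H), p, s] for post-decision states (E', Q') *)
Definition post_trans (k : MS) (H : csi) (p : bs_action) (s : ms_action)
    (E : energy) (Q : queue) (E' : energy) (Q' : queue) : R :=
  (E' == deplete E (p (serving k)))%:R *
  (success H p s k * (Q' == deplete Q true)%:R +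
   (1 - success H p s k) * (Q' == deplete Q false)%:R).

(* Pr[(E', Q') | (E, Q, H), p, s] for next states (E', Q') *)
Definition trans (k : MS) (H : csi) (p : bs_action) (s : ms_action)
    (E : energy) (Q : queue) (E' : energy) (Q' : queue) : R :=
  arrival_mean (arrE (serving k))
    (fun a => (E' == replenish (deplete E (p (serving k))) a)%:R) *
  (success H p s k *
     arrival_mean (arrQ k) (fun a => (Q' == replenish (deplete Q true) a)%:R) +
   (1 - success H p s k) *
     arrival_mean (arrQ k) (fun a => (Q' == replenish (deplete Q false) a)%:R)).

Definition flow_trans (k : MS) (p : bs_action) (E : energy) (Q : queue)
    (E' : energy) (Q' : queue) : R :=
  mean_Hs (fun H s => trans k H p s E Q E' Q').

Definition flow_post_trans (k : MS) (p : bs_action) (E : energy) (Q : queue)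
    (E' : energy) (Q' : queue) : R :=
  mean_Hs (fun H s => post_trans k H p s E Q E' Q').

Definition flow_Q_equation (theta : MS -> R)
    (Qf : MS -> energy -> queue -> bs_action -> R) : Prop :=
  forall k E Q p, p \in bs_actions sys ->
    theta k + Qf k E Q p =
    flow_cost k E Q (p (serving k)) +
    \sum_E' \sum_Q' flow_trans k p E Q E' Q' *
                    mean_p (fun p' => Qf k E' Q' p').

Definition flow_U_equation (theta : MS -> R)
    (Uf : MS -> energy -> queue -> R) : Prop :=
  forall k E0 Q0,
    theta k + Uf k E0 Q0 =
    arrival_mean (arrE (serving k)) (fun aE => arrival_mean (arrQ k) (fun aQ =>
      let E := replenish E0 aE in
      let Q := replenish Q0 aQ in
      mean_p (fun p => flow_cost k E Q (p (serving k))) +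
      \sum_E' \sum_Q' mean_p (fun p => flow_post_trans k p E Q E' Q') *
                      Uf k E' Q')).

Definition feasible (p : bs_action) : {set ms_action} :=
  [set s in ms_actions sys |
    [forall b : BS, (\sum_(k | serving k == b) s k)%N == p b]].

(* S_n(p_n) is cut out of the full cube {0,1}^{|K^(n)|}, not of a projection of
   ms_actions. *)
Definition cluster_feasible (n : CL) (pn : {ffun cluster_bs n -> bool}) :
    {set {ffun cluster_ms n -> bool}} :=
  [set sn : {ffun cluster_ms n -> bool} | [forall b : cluster_bs n,
    (\sum_(k : cluster_ms n | local_serving k == b) sn k)%N == pn b]].

Definition dtx_rule (Qf : MS -> energy -> queue -> bs_action -> R)
    (E : {ffun BS -> energy}) (Q : {ffun MS -> queue}) : {set bs_action} :=
  argmin (bs_actions sys)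
    (fun p => \sum_b \sum_(k | serving k == b) Qf k (E b) (Q k) p).

Definition linear_potential (Uf : MS -> energy -> queue -> R)
    (E : {ffun BS -> energy}) (Q : {ffun MS -> queue}) : R :=
  \sum_b \sum_(k | serving k == b) Uf k (E b) (Q k).

(* The user scheduling rule for a post-decision potential U. *)
Definition scheduling_rule
    (U : {ffun BS -> energy} -> {ffun MS -> queue} -> R)
    (E : {ffun BS -> energy}) (Q : {ffun MS -> queue}) (H : csi)
    (p : bs_action) : {set ms_action} :=
  argmin (feasible p) (fun s =>
    \sum_(d : {ffun MS -> bool})
      (\prod_k (1 - (d k)%:R - (-1) ^+ d k * success H p s k)) *
      U (depletev E p) (depletev Q d)).

Definition cluster_scheduling_rule (Uf : MS -> energy -> queue -> R) (n : CL)
    (En : {ffun cluster_bs n -> energy}) (Qn : {ffun cluster_ms n -> queue})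
    (Hn : {ffun cluster_ms n -> fading}) (p : bs_action) :
    {set {ffun cluster_ms n -> bool}} :=
  argmax (cluster_feasible (bs_part n p)) (fun sn : {ffun cluster_ms n -> bool} =>
    \sum_(k : cluster_ms n)
      (sn k)%:R * success_prob Hn p sn (val k) *
      (let e := deplete (En (local_serving k)) (p (serving (val k))) in
       Uf (val k) e (Qn k) - Uf (val k) e (deplete (Qn k) true))).

End System.

(* Main.v *)
(* The products over k are the weights of independent 0/1 departures d_k with
   P(d_k = 1) = Pr[rho_k >= delta_k], so by linearity of expectation the
   objective of the scheduling rule is
     sum_k U_k(e_k, Q_k)
       - sum_k Pr[rho_k >= delta_k] (U_k(e_k, Q_k) - U_k(e_k, [Q_k - 1]^+)),
   and only the second sum depends on s.  An unscheduled MS has zero received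
   power, hence zero success probability, which is why the factor s_k may be
   inserted.  Objective and constraints then split over the clusters, and
   maximizing a sum over a product of sets is maximizing each summand. *)
Require Import Defs.
From mathcomp Require Import all_boot all_order all_algebra.
From mathcomp Require Import all_classical all_reals all_analysis.
From mathcomp Require Import ring.

Set Implicit Arguments.
Unset Strict Implicit.
Unset Printing Implicit Defensive.

Import Order.TTheory GRing.Theory Num.Theory.
Local Open Scope ring_scope.

(** For each fixed [t0], the factor [f t0] is absorbed into the weight at [t0]. The sum of products
    then factors into a product of sums, where every index other than [t0] contributes 1. *)
Lemma expectation_sum_prod (R : comPzRingType) (T D : finType)
    (w f : T -> D -> R) :
  (forall t, \sum_x w t x = 1) ->
  \sum_(d : {ffun T -> D}) (\prod_t w t (d t)) * (\sum_t f t (d t)) =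
  \sum_t \sum_x w t x * f t x.
Proof.
move=> w1.
under eq_bigr => d _ do rewrite mulr_sumr.
rewrite exchange_big; apply: eq_bigr => t0 _ /=.
pose v t x := w t x * (if t == t0 then f t x else 1).
have vE d : (\prod_t w t (d t)) * f t0 (d t0) = \prod_t v t (d t).
  rewrite big_split /=; congr (_ * _).
  by rewrite -big_mkcond big_pred1_eq.
under eq_bigr => d _ do rewrite vE.
rewrite -(bigA_distr_bigA v) (bigD1 t0) //= [X in _ * X]big1 => [|t /negPf tt0].
  by rewrite mulr1; apply: eq_bigr => x _; rewrite /v eqxx.
by rewrite -(w1 t); apply: eq_bigr => x _; rewrite /v tt0 mulr1.
Qed.

(** Builds the competitor of an exchange argument: one block of [x] is replaced and the rest is
    kept. *)
Definition splice (T : finType) (V : Type) (P : pred T) (x : {ffun T -> V})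
    (y : {ffun {t | P t} -> V}) : {ffun T -> V} :=
  [ffun t => oapp y (x t) (insub t)].

Lemma subvec_splice (T : finType) (V : Type) (P : pred T)
    (x : {ffun T -> V}) (y : {ffun {t | P t} -> V}) :
  subvec P (splice x y) = y.
Proof. by apply/ffunP => u; rewrite !ffunE valK. Qed.

Lemma subvec_splice_disjoint (T : finType) (V : Type) (P P' : pred T)
    (x : {ffun T -> V}) (y : {ffun {t | P t} -> V}) :
  (forall t, P' t -> ~~ P t) -> subvec P' (splice x y) = subvec P' x.
Proof.
move=> dis; apply/ffunP => -[t Pt]; rewrite !ffunE /= insubF //.
exact/negbTE/dis.
Qed.

(** Replacing block [i] of a global maximizer by any element of [A i] stays admissible and changes
    only the summand [G i], so each block is itself optimal. Conversely, the blockwise inequalities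
    add up. *)
Lemma argmax_separable (R : realType) (I T V : finType) (c : T -> I)
    (A : forall i, {set {ffun {t | c t == i} -> V}})
    (G : forall i, {ffun {t | c t == i} -> V} -> R) :
  argmax [set x : {ffun T -> V} |
           [forall i, subvec (fun t => c t == i) x \in A i]]
    (fun x => \sum_i G i (subvec (fun t => c t == i) x)) =
  [set x | [forall i, subvec (fun t => c t == i) x \in argmax (A i) (@G i)]].
Proof.
apply/setP => x; rewrite !inE; apply/andP/forallP => [[/forallP xA xmax] i|xmax].
  rewrite inE xA; apply/forall_inP => y yA.
  have := forall_inP xmax (splice x y).
  have off j : j != i -> subvec (fun t => c t == j) (splice x y) =
                         subvec (fun t => c t == j) x.
    by move=> ji; apply: subvec_splice_disjoint => t /eqP ->.
  rewrite inE (bigD1 i) //= [leRHS](bigD1 i) //= subvec_splice.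
  rewrite (eq_bigr _ (fun j ji => congr1 (@G j) (off j ji))) lerD2r; apply.
  by apply/forallP => j; have [->|/off ->] := eqVneq j i;
    rewrite ?subvec_splice.
have xA i : subvec (fun t => c t == i) x \in A i.
  by have := xmax i; rewrite inE => /andP[].
split; first exact/forallP.
apply/forall_inP => y; rewrite inE => /forallP yA.
apply: ler_sum => i _; have := xmax i; rewrite inE => /andP[_ /forall_inP].
by apply; exact: yA.
Qed.

Lemma argmin_subl (R : realType) (T : finType) (A : {set T}) (F G : T -> R)
    (a : R) :
  (forall x, F x = a - G x) -> argmin A F = argmax A G.
Proof.
move=> FG; apply/setP => x; rewrite !inE; congr (_ && _).
by apply: eq_forallb => y; rewrite !FG lerD2l lerN2.
Qed.

Lemma deplete_false (m : nat) (x : 'I_m.+1) : deplete x false = x.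
Proof. by rewrite /deplete subn0 inord_val. Qed.

Section Scheduling.
Variables (R : realType) (sys : system R).

Lemma success_clusterE (H : csi sys) p s n (k : 'I_(nMS sys)) :
  Defs.cluster (serving k) = n ->
  success H p s k = success_prob (ms_part n H) p (ms_part n s) k.
Proof. by move=> <-. Qed.

(* The outer schedule is a random schedule of the whole network, but it agrees
   with s on the cluster of k, so the received power of k vanishes surely. *)
Lemma success_unscheduled (hsys : standing sys) (H : csi sys) p
    (s : ms_action sys) k :
  s k = false -> success H p s k = 0.
Proof.
move=> sk; rewrite /success /success_prob big1 // => h _.
rewrite big1 ?mulr0 // => s' _.
have [/eqP s's|s's] :=
    boolP (ms_part (Defs.cluster (serving k)) s' ==
           ms_part (Defs.cluster (serving k)) s); last first.
  have [_ _ ->] := outer_schedule_pmf hsys h p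
    (ms_part (Defs.cluster (serving k)) s); first by rewrite mul0r.
  by rewrite inE.
have s'k : s' k = false.
  have /ffunP/(_ (exist _ k (eqxx _))) := s's.
  by rewrite !ffunE /= sk.
(* The numerator vanishes, so the SINR is 0 whatever its denominator, and a positive threshold is
   not met. *)
rewrite /sinr /rx_power s'k mulr0 mul0r leNgt (threshold_gt0 hsys) /=.
by rewrite mulr0.
Qed.

Lemma linear_potentialE (Uf : 'I_(nMS sys) -> energy sys -> queue sys -> R)
    E Q :
  linear_potential Uf E Q = \sum_k Uf k (E (serving k)) (Q k).
Proof.
rewrite [RHS](partition_big (@serving R sys) xpredT) //=.
by apply: eq_bigr => b _; apply: eq_bigr => k /eqP ->.
Qed.

Lemma scheduling_objectiveE
    (Uf : 'I_(nMS sys) -> energy sys -> queue sys -> R)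
    (E : {ffun 'I_(nBS sys) -> energy sys})
    (Q : {ffun 'I_(nMS sys) -> queue sys}) (H : csi sys)
    (p : bs_action sys) (s : ms_action sys) :
  let e k := deplete (E (serving k)) (p (serving k)) in
  \sum_(d : {ffun 'I_(nMS sys) -> bool})
    (\prod_k (1 - (d k)%:R - (-1) ^+ d k * success H p s k)) *
    linear_potential Uf (depletev E p) (depletev Q d) =
  \sum_k Uf k (e k) (Q k) -
  \sum_k success H p s k *
    (Uf k (e k) (Q k) - Uf k (e k) (deplete (Q k) true)).
Proof.
move=> e.
(* This equals [success H p s k] at [true] and its complement to 1 at [false]. *)
pose w k (x : bool) : R := 1 - x%:R - (-1) ^+ x * success H p s k.
pose f k x := Uf k (e k) (deplete (Q k) x).
transitivity (\sum_(d : {ffun 'I_(nMS sys) -> bool})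
    (\prod_k w k (d k)) * (\sum_k f k (d k))).
  apply: eq_bigr => d _; rewrite linear_potentialE; congr (_ * _).
  by apply: eq_bigr => k _; rewrite !ffunE.
rewrite expectation_sum_prod => [|k]; last first.
  by rewrite big_bool /w /=; ring.
rewrite -sumrB; apply: eq_bigr => k _.
by rewrite big_bool /w /f deplete_false /=; ring.
Qed.

Lemma sum_clusters (F : 'I_(nMS sys) -> R) :
  \sum_k F k = \sum_n \sum_(k : @cluster_ms R sys n) F (val k).
Proof.
rewrite (partition_big (fun k => Defs.cluster (serving k)) xpredT) //=.
by apply: eq_bigr => n _; exact: big_sub.
Qed.

(** All MSs of a BS lie in the cluster of that BS, so the sum within the cluster misses none of
    them, and each BS is constrained by exactly one cluster. *)
Lemma cluster_feasibleP (p : bs_action sys) (s : ms_action sys) :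
  [forall n, ms_part n s \in cluster_feasible (bs_part n p)] =
  [forall b, (\sum_(k | serving k == b) s k)%N == p b].
Proof.
have sumE n (b : @cluster_bs R sys n) :
    (\sum_(k | local_serving k == b) ms_part n s k)%N =
    (\sum_(k | serving k == val b) s k)%N.
  transitivity (\sum_(k in in_cluster_ms n | serving k == val b) s k)%N.
    rewrite big_sub_cond; apply: eq_big => [k|k _]; first by rewrite -val_eqE.
    by rewrite ffunE.
  apply: eq_bigl => k; apply: andb_idl => /eqP kb.
  by rewrite unfold_in /in_cluster_ms kb; exact: valP b.
apply/forallP/forallP => [sp b|sp n].
  have := sp (Defs.cluster b); rewrite inE => /forallP/(_ (exist _ b (eqxx _))).
  by rewrite sumE ffunE.
by rewrite inE; apply/forallP => b; rewrite sumE ffunE; apply: sp.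
Qed.

End Scheduling.

Theorem lemma4 (R : realType) (sys : system R) (hsys : standing sys)
    (om : base_policy sys)
    (theta : 'I_(nMS sys) -> R)
    (Qf : 'I_(nMS sys) -> energy sys -> queue sys -> bs_action sys -> R)
    (Uf : 'I_(nMS sys) -> energy sys -> queue sys -> R)
    (hQf : flow_Q_equation om theta Qf)
    (hUf : flow_U_equation om theta Uf)
    (hS : forall (p : bs_action sys) (s : ms_action sys),
        p \in bs_actions sys ->
        (forall n, ms_part n s \in cluster_feasible (bs_part n p)) ->
        s \in ms_actions sys)
    (E : {ffun 'I_(nBS sys) -> energy sys})
    (Q : {ffun 'I_(nMS sys) -> queue sys})
    (H : csi sys)
    (p : bs_action sys) (hp : p \in dtx_rule Qf E Q) :
  scheduling_rule (linear_potential Uf) E Q H p =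
  [set s : ms_action sys | [forall n : 'I_(nCl sys),
     ms_part n s \in
       cluster_scheduling_rule Uf (bs_part n E) (ms_part n Q) (ms_part n H) p]].
Proof.
have pA : p \in bs_actions sys by move: hp; rewrite inE => /andP[].
pose G n (sn : {ffun cluster_ms n -> bool}) : R :=
  \sum_(k : cluster_ms n)
    (sn k)%:R * success_prob (ms_part n H) p sn (val k) *
    (let e := deplete (bs_part n E (local_serving k)) (p (serving (val k))) in
     Uf (val k) e (ms_part n Q k) -
     Uf (val k) e (deplete (ms_part n Q k) true)).
have feasE : feasible p = [set s |
    [forall n, ms_part n s \in cluster_feasible (bs_part n p)]].
  apply/setP => s; rewrite !inE -cluster_feasibleP andb_idl //.
  by move=> /forallP; apply: hS.
rewrite /scheduling_rule feasE.
set F := (X in argmin _ X).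
have FE s : F s = \sum_k Uf k (deplete (E (serving k)) (p (serving k))) (Q k) -
                  \sum_n G n (ms_part n s).
  rewrite /F scheduling_objectiveE [X in _ - X]sum_clusters; congr (_ - _).
  apply: eq_bigr => n _; apply: eq_bigr => -[k kn] _; rewrite !ffunE /=.
  rewrite -success_clusterE; last exact/eqP.
  by case: (boolP (s k)) => [_|/negbTE sk];
    rewrite ?mul1r // success_unscheduled // !mul0r.
rewrite (argmin_subl _ FE).
(* Here [c] sends an MS to the cluster of its serving BS; [ms_part] and [cluster_scheduling_rule]
   unfold to the required blocks and argmax. *)
exact: argmax_separable.
Qed.
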